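(* Let $p\ge 1$ and let $\mathcal{M}$, $\mathbb{X}_p(\mathcal{M})$, the lifting $\mathsf{L}$, the penalty $\alpha$, the bilinear form $a_h$ and the norm $\|\cdot\|_{\rm DG}$ be as described in the context. Let $c_{\mathsf{L}}>0$ be a constant, independent of $p$, the mesh $\mathcal{M}$ and the coefficient $a$, such that $\|a^{1/2}\mathsf{L}(v)\|_{\mathcal{M}}\le c_{\mathsf{L}}\|\alpha^{1/2}[[v]]\|_{\mathcal{E}}$ for all $v\in\mathbb{X}_p(\mathcal{M})$. Then $$a_h(v,v)\ge(4+c_{\mathsf{L}}^2)^{-1}\|v\|_{\rm DG}^2\qquad\forall v\in\mathbb{X}_p(\mathcal{M}).$$
   Context: Setting. $\Omega\subset\mathbb{R}^2$ is a bounded Lipschitz domain which is a union of bounded axis-parallel rectangles. $\Gamma$ is a Lipschitz and piecewise $C^2$-smooth interface dividing $\Omega$ into $\Omega_1,\Omega_2$ with $\bar\Omega_1\subset\Omega$, $\Omega_2=\Omega\setminus\bar\Omega_1$, $\Gamma=\partial\Omega_1\cap\partial\Omega_2$. Points where $\Gamma$ is not $C^2$ are called singular points. The coefficient is $a=a_1\chi_{\Omega_1}+a_2\chi_{\Omega_2}$ with constants $a_1,a_2>0$. Mesh. $\mathcal{T}$ is a Cartesian mesh of $\Omega$: its elements are open rectangles with sides parallel to the coordinate axes, with possible local refinements and hanging nodes. $h_K$ is the diameter of $K$. $\Gamma$ intersects the boundary of each element it meets at most twice, at different (open) sides, and each element contains at most one singular point of $\Gamma$. Large elements. Fix $\delta_0\in(0,1/2)$.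 A rectangle $K$ is large with respect to $\Omega_i$ if $K\subset\Omega_i$, or if $K\cap\Gamma\ne\emptyset$ and $|e\cap\Omega_i|\ge\delta_0|e|$ for each side $e$ of $K$ with $e\cap\Omega_i\neq\emptyset$ and, if moreover $K$ has only one vertex $A_K^i$ in $\Omega_i$ and contains a singular point $Q_K$ of $\Gamma$, then $\mathrm{dist}(Q_K,e_j)\ge\frac12\delta_0\min(|e_1|,|e_2|)$, $j=1,2$, where $e_1,e_2$ are the sides of $K$ with end point $A_K^i$. Large elements with respect to $\Omega_i$ having only one vertex in $\Omega_i$ and containing a singular point are called irregular; other large elements are called regular. Interface deviation. For $K\cap\Gamma\ne\emptyset$, $\Gamma_K=\Gamma\cap K$ and $\Gamma_K^h$ is the open segment joining the two points of $\Gamma\cap\partial K$. If $K$ contains a singular point $Q_K$, $\Gamma_K$ is the union of two $C^2$ curves $\Gamma_{1K},\Gamma_{2K}$ and $\Gamma_{jK}^h$ is the open segment joining $Q_K$ and the point $\Gamma_{jK}\cap\partial K$. Set $\eta_K=\max(\eta_K^1,\eta_K^2)$, where $\eta_K^i=\mathrm{dist}_{\rm H}(\Gamma_K,\Gamma_K^h)/\mathrm{dist}(A_K^i,\Gamma_K^h)$ if $K$ is a regular large element with respect to $\Omega_i$, with $A_K^i\in\Omega_i$ the vertex of $K$ in $\Omega_i$ of maximum distance to $\Gamma_K^h$, and $\eta_K^i=\max_{j=1,2}\mathrm{dist}_{\rm H}(\Gamma_{jK},\Gamma_{jK}^h)/\mathrm{dist}(A_K^i,\Gamma_{jK}^h)$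 if $K$ is an irregular large element with respect to $\Omega_i$ with vertex $A_K^i\in\Omega_i$. Here $\mathrm{dist}_{\rm H}(\Gamma_1,\Gamma_2)=\max_{x\in\Gamma_1}\min_{y\in\Gamma_2}|x-y|$. Induced mesh. $\mathcal{M}$ is a Cartesian mesh of $\Omega$ obtained from $\mathcal{T}$ by merging interface elements $K$ with neighboring elements into rectangular macro-elements of size comparable to $h_K$, such that every element of $\mathcal{M}$ meeting $\Gamma$ is large with respect to both $\Omega_1$ and $\Omega_2$ and satisfies $\eta_K\le\max(1/2,(1-\delta_0)/(1+\delta_0))$; $\Gamma$ intersects the boundary of each element of $\mathcal{M}$ it meets twice at different sides, and each such element contains at most one singular point. $\mathcal{M}^\Gamma=\{K\in\mathcal{M}:K\cap\Gamma\neq\emptyset\}$. Spaces and sides. $Q_p(K)$ is the set of polynomials on $K$ of degree at most $p$ in each variable. $\mathbb{X}_p(\mathcal{M})=\{v_1\chi_{\Omega_1}+v_2\chi_{\Omega_2}:v_i|_K\in Q_p(K)\ \forall K\in\mathcal M,\ i=1,2\}$; $H^1(\mathcal{M})$ is defined likewise with $v_i|_K\in H^1(K)$. For $v=v_1\chi_{\Omega_1}+v_2\chi_{\Omega_2}$, $\nabla_hv|_K=\nabla v_1\chi_{K\cap\Omega_1}+\nabla v_2\chi_{K\cap\Omega_2}$. $\mathcal{E}=\mathcal{E}^{\rm side}\cup\mathcal{E}^\Gamma\cup\mathcal{E}^{\rm bdy}$ with $\mathcal{E}^{\rm side}=\{e=\partial K\cap\partial K':K,K'\in\mathcal{M}\}$,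 $\mathcal{E}^\Gamma=\{\Gamma_K:K\in\mathcal{M}\}$, $\mathcal{E}^{\rm bdy}=\{e=\partial K\cap\partial\Omega:K\in\mathcal{M}\}$. For $i=1,2$, $\mathcal{M}_i=\{K\in\mathcal{M}:K\cap\Omega_i\ne\emptyset\}$, $\Omega_i^h=\cup\{K:K\in\mathcal{M}_i\}$, and $\mathcal{E}_i^{\rm side}$ is the set of sides of $\mathcal{M}_i$ not on $\partial\Omega_i^h$. $\bar{\mathcal{E}}=\mathcal{E}_1^{\rm side}\cup\mathcal{E}_2^{\rm side}\cup\mathcal{E}^\Gamma\cup\mathcal{E}^{\rm bdy}$. For $e\in\mathcal{E}$ fix a unit normal $n_e$ (outer to $\Omega$ on $\mathcal{E}^{\rm bdy}$, outer to $\Omega_1$ on $\mathcal{E}^\Gamma$), and $n|_e=n_e$. With $v_\pm$ the trace of $v$ on $e$ from the side in direction $\pm n_e$, the jump is $[[v]]_e=v_--v_+$ for $e\in\mathcal{E}^{\rm side}\cup\mathcal{E}^\Gamma$ and $[[v]]_e=v_-$ for $e\in\mathcal{E}^{\rm bdy}$. $(u,v)_{\mathcal{M}}=\sum_{K}(u,v)_{L^2(K)}$, and for a set of sides $\hat{\mathcal E}$, $\langle u,v\rangle_{\hat{\mathcal{E}}}=\sum_{e\in\hat{\mathcal E}}\langle u,v\rangle_{L^2(e)}$, with induced norms. For $v,w\in H^1(\mathcal M)$, $$\langle\alpha[[v]],[[w]]\rangle_{\bar{\mathcal{E}}}:=\sum_{i=1}^2\langle\alpha[[v_i]],[[w_i]]\rangle_{\mathcal{E}_i^{\rm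 side}}+\langle\alpha[[v]],[[w]]\rangle_{\mathcal{E}^\Gamma\cup\mathcal{E}^{\rm bdy}},\quad \|\alpha^{1/2}[[v]]\|_{\bar{\mathcal E}}^2:=\langle\alpha[[v]],[[v]]\rangle_{\bar{\mathcal E}}.$$ Lifting. $\mathsf{L}(v)\in[\mathbb{X}_p(\mathcal{M})]^2$ is defined by $(r,\mathsf{L}(v))_{\mathcal{M}}=\langle\hat r\cdot n,[[v]]\rangle_{\mathcal{E}}$ for all $r\in[\mathbb{X}_p(\mathcal{M})]^2$, where $\hat r|_e=\beta_er_-+(1-\beta_e)r_+$ with $\beta_e\in\{0,1\}$ fixed for $e\in\mathcal{E}^{\rm side}\cup\mathcal{E}^\Gamma$ and $\beta_e=1$ for $e\in\mathcal{E}^{\rm bdy}$. Penalty. $\alpha|_e=\alpha_0\hat a_e\hat\Theta_eh_e^{-1}p^2$ for $e\in\mathcal{E}$, with $\alpha_0>0$ a fixed constant, $\hat a_e=\max\{a_K:e\cap\bar K\ne\emptyset\}$, $\hat\Theta_e=\max\{\Theta_K:e\cap\bar K\neq\emptyset\}$; $a_K=(a_1+a_2)/2$ if $K\in\mathcal{M}^\Gamma$ and $a_K=a_i$ if $K\subset\Omega_i$; $\Theta_K=\mathsf{T}\left(\frac{1+3\eta_K}{1-\eta_K}\right)^{4p}$ if $K\in\mathcal{M}^\Gamma$ and $\Theta_K=1$ otherwise, $\mathsf{T}(t)=t+\sqrt{t^2-1}$; $h_e=(h_K+h_{K'})/2$ if $e=\partial K\cap\partial K'\in\mathcal{E}^{\rm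 side}$, and $h_e=h_K$ if $e=K\cap\Gamma\in\mathcal{E}^\Gamma$ or $e=\partial K\cap\partial\Omega\in\mathcal{E}^{\rm bdy}$. Bilinear form and norm. $a_h(v,w)=(a(\nabla_hv-\mathsf{L}(v)),\nabla_hw-\mathsf{L}(w))_{\mathcal{M}}+\langle\alpha[[v]],[[w]]\rangle_{\bar{\mathcal{E}}}$ and $\|v\|_{\rm DG}^2=\|a^{1/2}\nabla_hv\|_{\mathcal{M}}^2+\|\alpha^{1/2}[[v]]\|_{\bar{\mathcal{E}}}^2$. *)

(* Defs.v *)
From HB Require Import structures.
From mathcomp Require Import all_boot all_order all_algebra.
From mathcomp Require Import all_classical all_reals all_analysis.

Set Implicit Arguments.
Unset Strict Implicit.
Unset Printing Implicit Defensive.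

Import Order.TTheory GRing.Theory Num.Theory.
Import numFieldNormedType.Exports.

Local Open Scope classical_set_scope.
Local Open Scope ring_scope.

(* The library norm on R * R is the sup norm: Euclidean distances and lengths
   are defined here explicitly.  The topology is the same. *)
Notation plane R := (R * R)%type.

Section PlaneGeometry.
Context {R : realType}.
Implicit Types (x y n : plane R) (A B : set (plane R)).

Definition dot x y : R := x.1 * y.1 + x.2 * y.2.

Definition enorm x : R := Num.sqrt (dot x x).

Definition eucl_dist x y : R := enorm (x - y).

Definition dist_to x A : R := inf [set eucl_dist x y | y in A].

(* One-sided, as in the source. *)
Definition distH A B : R := sup [set dist_to x B | x in A].

Definition diam A : R := sup [set eucl_dist z.1 z.2 | z in A `*` A].

Definition bd A : set (plane R) := closure A `\` interior A.

Definition open_segment x y : set (plane R) :=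
  [set (1 - t) *: x + t *: y | t in [set t : R | 0 < t < 1]].

Definition trace {V : normedModType R} A (f : plane R -> V) x : V :=
  lim (f @ within A (nbhs x)).

Definition grad (f : plane R -> R) x : plane R :=
  (derive1 (fun s => f (s, x.2)) x.1, derive1 (fun s => f (x.1, s)) x.2).

Definition C2 (f : R -> R) : Prop :=
  [/\ forall t, derivable f t 1, forall t, derivable (derive1 f) t 1
    & continuous (derive1 (derive1 f))].

(* In the orthonormal frame (c, s), (- s, c) attached to x, A is near x the
   region below the graph of a Lipschitz function. *)
Definition lipschitz_boundary A : Prop :=
  forall x, bd A x -> exists (c s r k : R) (phi : R -> R),
    [/\ c ^+ 2 + s ^+ 2 = 1, 0 < r, k.-lipschitz phi
      & forall y, eucl_dist y x < r ->
        (A y <-> dot (y - x) (- s, c) < phi (dot (y - x) (c, s)))].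

(* Near x the set A is the graph of a C^2 function, in some frame. *)
Definition C2_curve_at A x : Prop :=
  exists (c s r : R) (phi : R -> R),
    [/\ c ^+ 2 + s ^+ 2 = 1, 0 < r, C2 phi
      & forall y, eucl_dist y x < r ->
        (A y <-> dot (y - x) (- s, c) = phi (dot (y - x) (c, s)))].

Definition singular A x : Prop := A x /\ ~ C2_curve_at A x.

Definition velocity (g : R -> plane R) (t : R) : plane R :=
  (derive1 (fst \o g) t, derive1 (snd \o g) t).

(* The tangent direction rotated clockwise by a right angle. *)
Definition right_normal (g : R -> plane R) (t : R) : plane R :=
  (enorm (velocity g t))^-1 *: ((velocity g t).2, - (velocity g t).1).

(* An arc is the image of [0, 1]; it is C^2 up to its end points, which is
   expressed by letting g be C^2 on the whole line.  It may be a loop. *)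
Definition C2_arc (g : R -> plane R) : Prop :=
  [/\ C2 (fst \o g), C2 (snd \o g),
      forall t, 0 <= t <= 1 -> velocity g t <> 0
    & forall t t', 0 <= t <= 1 -> 0 < t' < 1 -> g t = g t' -> t = t'].

End PlaneGeometry.

Section Rectangles.
Context {R : realType}.

(* K stands for ]K.1.1, K.1.2[ x ]K.2.1, K.2.2[. *)
Definition rect : Type := ((R * R) * (R * R))%type.

Implicit Types (K : rect) (s b : bool * bool).

Definition box K : set (plane R) :=
  [set x | K.1.1 < x.1 < K.1.2 /\ K.2.1 < x.2 < K.2.2].

(* The sides of K are indexed by s: s.1 tells whether the side is vertical,
   s.2 whether it is the right (or upper) one. *)
Definition side_range K s : R * R := if s.1 then K.2 else K.1.

Definition side_point K s (t : R) : plane R :=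
  if s.1 then (if s.2 then K.1.2 else K.1.1, t)
  else (t, if s.2 then K.2.2 else K.2.1).

Definition side_normal s : plane R :=
  let e : R := if s.2 then 1 else -1 in if s.1 then (e, 0) else (0, e).

Definition side_length K s : R := (side_range K s).2 - (side_range K s).1.

Definition open_side K s : set (plane R) :=
  side_point K s @`
    [set t : R | (side_range K s).1 < t < (side_range K s).2].

Definition closed_side K s : set (plane R) :=
  side_point K s @`
    [set t : R | (side_range K s).1 <= t <= (side_range K s).2].

Definition vertex K b : plane R :=
  (if b.1 then K.1.2 else K.1.1, if b.2 then K.2.2 else K.2.1).

(* The one-dimensional measure of the part of a side lying in A. *)
Definition side_measure K s (A : set (plane R)) : \bar R :=
  lebesgue_measure [set t : R |
    (side_range K s).1 <= t <= (side_range K s).2 /\ A (side_point K s t)].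

(* The integral over the part of the boundary of K lying in A, with respect to
   arc length; the integrand also receives the outer unit normal of K. *)
Definition boundary_integral K (A : set (plane R))
    (f : plane R -> plane R -> R) : R :=
  \sum_(s : bool * bool)
    \int[lebesgue_measure]_(t in [set t : R |
        (side_range K s).1 < t < (side_range K s).2 /\ A (side_point K s t)])
      f (side_point K s t) (side_normal s).

Definition cartesian_mesh (A : set (plane R)) (T : seq rect) : Prop :=
  [/\ uniq T,
      forall K, K \in T -> [/\ K.1.1 < K.1.2, K.2.1 < K.2.2 & box K `<=` A],
      forall K K', K \in T -> K' \in T -> K != K' -> box K `&` box K' = set0
    & closure A = [set x | exists2 K, K \in T & closure (box K) x]].

(* v restricted to K coincides with a polynomial of degree <= p in each
   variable. *)
Definition in_Qp (p : nat) K (v : plane R -> R) : Prop :=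
  exists c : 'M[R]_p.+1, forall x, box K x ->
    v x = \sum_(i < p.+1) \sum_(j < p.+1) c i j * x.1 ^+ i * x.2 ^+ j.

End Rectangles.
Arguments rect : clear implicits.

Section Geometry.
Context {R : realType}.

(* Omega, Omega_1 and a parametrization of the interface. *)
Record geometry : Type := Geometry {
  dom : set (plane R);
  dom1 : set (plane R);
  arcs : seq (R -> plane R) }.

Implicit Types (G : geometry) (i : 'I_2) (K : rect R) (x : plane R).

Definition dom2 G : set (plane R) := dom G `\` closure (dom1 G).

(* The indices 1, 2 of the source are 0, 1 in 'I_2. *)
Definition subdom G i : set (plane R) := if i == 0 then dom1 G else dom2 G.

Definition Gam G : set (plane R) := bd (dom1 G) `&` bd (dom2 G).

Definition meets G K : Prop := box K `&` Gam G !=set0.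

(* The arcs are disjoint up to end points and oriented so that right_normal
   is the unit normal outer to Omega_1. *)
Definition interface_arcs G : Prop :=
  [/\ forall k, (k < size (arcs G))%N -> C2_arc (nth (fun=> 0) (arcs G) k),
      forall k l, (k < size (arcs G))%N -> (l < size (arcs G))%N -> k <> l ->
        forall t t', 0 < t < 1 -> 0 <= t' <= 1 ->
          nth (fun=> 0) (arcs G) k t <> nth (fun=> 0) (arcs G) l t',
      Gam G = [set x | exists2 k, (k < size (arcs G))%N &
                 exists2 t, 0 <= t <= 1 & x = nth (fun=> 0) (arcs G) k t]
    & forall k, (k < size (arcs G))%N -> forall t, 0 < t < 1 ->
        let g := nth (fun=> 0) (arcs G) k in
        \forall e \near 0^'+, dom1 G (g t - e *: right_normal g t) /\
                              dom2 G (g t + e *: right_normal g t)].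

Definition interface_geometry G : Prop :=
  [/\ [/\ open (dom G), connected (dom G), dom G !=set0, bounded_set (dom G)
        & lipschitz_boundary (dom G)],
      exists Q : seq (rect R), dom G = [set x | exists2 K, K \in Q & box K x],
      [/\ open (dom1 G), dom1 G !=set0, closure (dom1 G) `<=` dom G
        & lipschitz_boundary (dom1 G)]
    & interface_arcs G].

(* The integral over Gamma `&` K with respect to arc length; the integrand
   also receives the unit normal outer to Omega_1. *)
Definition interface_integral G K (f : plane R -> plane R -> R) : R :=
  \sum_(g <- arcs G)
    \int[lebesgue_measure]_(t in [set t : R | 0 < t < 1 /\ box K (g t)])
      (f (g t) (right_normal g t) * enorm (velocity g t)).

(* A is the only vertex of K in Omega_i. *)
Definition only_vertex G i K (A : plane R) : Prop :=
  [/\ subdom G i A, exists b, A = vertex K b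
    & forall b, subdom G i (vertex K b) -> vertex K b = A].

Definition large G (delta0 : R) i K : Prop :=
  box K `<=` subdom G i \/
  [/\ meets G K,
      forall s, closed_side K s `&` subdom G i !=set0 ->
        ((delta0 * side_length K s)%:E <= side_measure K s (subdom G i))%E
    & forall A Q, only_vertex G i K A -> box K Q -> singular (Gam G) Q ->
        forall s, closed_side K s A ->
          delta0 / 2 * Num.min (K.1.2 - K.1.1) (K.2.2 - K.2.1)
            <= dist_to Q (closed_side K s)].

(* Regularity is only meaningful for large elements. *)
Definition irregular G i K : Prop :=
  (exists A, only_vertex G i K A) /\
  (exists2 Q, box K Q & singular (Gam G) Q).

(* Gamma_K^h; here Gamma meets the boundary of K in exactly two points. *)
Definition chord G K : set (plane R) :=
  [set z | exists x y, [/\ (Gam G `&` bd (box K)) x,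
     (Gam G `&` bd (box K)) y, x <> y & open_segment x y z]].

(* For Q singular in K and B in Gamma `&` bd K, the branch Gamma_jK from Q to
   B, without the end point Q. *)
Definition branch G K (Q B : plane R) : set (plane R) :=
  connected_component ((Gam G `&` closure (box K)) `\` [set Q]) B.

(* In the regular case the denominator is the distance to Gamma_K^h of the
   vertex of K in Omega_i of maximum distance.  In the irregular case the sup
   is the maximum over the two branches. *)
Definition eta_i G i K : R :=
  if `[< irregular G i K >] then
    sup [set r | exists A Q B, [/\ only_vertex G i K A,
           (box K `&` singular (Gam G)) Q, (Gam G `&` bd (box K)) B
         & r = distH (branch G K Q B) (open_segment Q B) /
               dist_to A (open_segment Q B)]]
  else
    distH (Gam G `&` box K) (chord G K) /
    \big[Num.max/0]_(b : bool * bool | `[< subdom G i (vertex K b) >])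
      dist_to (vertex K b) (chord G K).

Definition eta G K : R := Num.max (eta_i G 0 K) (eta_i G 1 K).

Definition at_most_one_singular_point G K : Prop :=
  forall Q Q', box K Q -> box K Q' -> singular (Gam G) Q ->
    singular (Gam G) Q' -> Q = Q'.

(* Imposed on all elements, so Gamma cannot run along a mesh line. *)
Definition crossed_at_most_twice G K : Prop :=
  [/\ Gam G `&` bd (box K) `<=` [set x | exists s, open_side K s x],
      forall s x y, (Gam G `&` open_side K s) x ->
        (Gam G `&` open_side K s) y -> x = y
    & forall x y z, (Gam G `&` bd (box K)) x -> (Gam G `&` bd (box K)) y ->
        (Gam G `&` bd (box K)) z -> [\/ x = y, x = z | y = z]].

Definition crossed_twice G K : Prop :=
  exists s s' x y, [/\ s != s', closed_side K s x, closed_side K s' y, x <> y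
    & Gam G `&` bd (box K) = [set x; y]].

Definition initial_mesh G (T : seq (rect R)) : Prop :=
  cartesian_mesh (dom G) T /\
  forall K, K \in T ->
    crossed_at_most_twice G K /\ at_most_one_singular_point G K.

(* An element of M is an element of T, or a macro-element made of an interface
   element K0 of T and other elements of T; kappa is the constant hidden in
   "of size comparable to". *)
Definition induced_mesh G (delta0 kappa : R) (T M : seq (rect R)) : Prop :=
  [/\ cartesian_mesh (dom G) M,
      forall K, K \in M -> K \in T \/
        exists K0, [/\ K0 \in T, meets G K0, box K0 `<=` box K,
          closure (box K) = [set x | exists K1,
            [/\ K1 \in T, box K1 `<=` box K & closure (box K1) x]]
        & diam (box K) <= kappa * diam (box K0)]
    & forall K, K \in M -> meets G K ->
        [/\ forall i, large G delta0 i K,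
            eta G K <= Num.max (1 / 2) ((1 - delta0) / (1 + delta0)),
            crossed_twice G K & at_most_one_singular_point G K]].

End Geometry.
Arguments geometry : clear implicits.

Section Method.
Context {R : realType}.

(* v = v_1 chi_1 + v_2 chi_2 is given by the family (v_i). *)
Definition pwfun (V : Type) : Type := 'I_2 -> plane R -> V.

(* deg is the degree p, coef the constants a_1, a_2, mesh0 and mesh the meshes
   T and M.  An interior side is a pair (K, K') of elements, standing for the
   set bd K `&` bd K'; ori K K' says that n_e is the outer normal of K, so that
   v_- and v_+ are the traces from K and K'.  beta_side and beta_gam are the
   switches beta_e, lifting is the map L. *)
Record method : Type := Method {
  deg : nat;
  coef : 'I_2 -> R;
  mesh0 : seq (rect R);
  mesh : seq (rect R);
  ori : rect R -> rect R -> bool;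
  beta_side : rect R * rect R -> bool;
  beta_gam : rect R -> bool;
  lifting : pwfun R -> pwfun (plane R) }.

Variables (G : geometry R) (d : method).
Implicit Types (i : 'I_2) (K : rect R) (e : rect R * rect R) (x n : plane R).

Definition pw_glue {V : normedModType R} (v : pwfun V) x : V :=
  \sum_(i < 2) \1_(subdom G i) x *: v i x.

Definition broken_poly (v : pwfun R) : Prop :=
  forall i K, K \in mesh d -> in_Qp (deg d) K (v i).

Definition broken_poly2 (r : pwfun (plane R)) : Prop :=
  broken_poly (fun i x => (r i x).1) /\ broken_poly (fun i x => (r i x).2).

Definition coef_fun x : R := pw_glue (fun i _ => coef d i : R^o) x.

Definition gradh (v : pwfun R) x : plane R := pw_glue (fun i => grad (v i)) x.

Definition ipM (u w : plane R -> plane R) : R :=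
  \sum_(K <- mesh d)
    \int[(lebesgue_measure \x lebesgue_measure)%E]_(x in box K)
      dot (u x) (w x).

Definition normM (u : plane R -> plane R) : R := Num.sqrt (ipM u u).

Definition side_set e : set (plane R) := bd (box e.1) `&` bd (box e.2).

(* Each side occurs once.  Pairs of elements whose boundaries are disjoint or
   share only a corner also occur but carry zero length. *)
Definition sides : seq (rect R * rect R) :=
  [seq e <- [seq (K, K') | K <- mesh d, K' <- mesh d]
     | (e.1 != e.2) && ori d e.1 e.2].

Definition in_mesh_i i K : Prop :=
  K \in mesh d /\ box K `&` subdom G i !=set0.

(* Omega_i^h; the elements being open, the interior of the union of their
   closures is taken. *)
Definition hull i : set (plane R) :=
  interior [set x | exists2 K, in_mesh_i i K & closure (box K) x].

(* Sides of M_i on bd Omega are on bd Omega_i^h, hence are never kept. *)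
Definition sides_i i : seq (rect R * rect R) :=
  [seq e <- sides | `[< (in_mesh_i i e.1 \/ in_mesh_i i e.2) /\
                        ~ (side_set e `<=` bd (hull i)) >]].

Definition coef_elt K : R :=
  if `[< meets G K >] then (coef d 0 + coef d 1) / 2
  else if `[< box K `<=` dom1 G >] then coef d 0 else coef d 1.

Definition growth (t : R) : R := t + Num.sqrt (t ^+ 2 - 1).

Definition Theta_elt K : R :=
  if `[< meets G K >] then
    growth ((1 + 3 * eta G K) / (1 - eta G K)) ^+ (4 * deg d)
  else 1.

(* The maximum of f over the elements whose closure meets the side e. *)
Definition side_max (f : rect R -> R) (e : set (plane R)) : R :=
  \big[Num.max/0]_(K <- mesh d | `[< e `&` closure (box K) !=set0 >]) f K.

Definition penalty (alpha0 : R) (e : set (plane R)) (h : R) : R :=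
  alpha0 * side_max coef_elt e * side_max Theta_elt e * h^-1 * (deg d)%:R ^+ 2.

Definition gam_set K : set (plane R) := Gam G `&` box K.

Definition bdy_set K : set (plane R) := bd (box K) `&` bd (dom G).

Definition penalty_side (alpha0 : R) e : R :=
  penalty alpha0 (side_set e) ((diam (box e.1) + diam (box e.2)) / 2).

Definition penalty_gam (alpha0 : R) K : R :=
  penalty alpha0 (gam_set K) (diam (box K)).

Definition penalty_bdy (alpha0 : R) K : R :=
  penalty alpha0 (bdy_set K) (diam (box K)).

Definition jump {V : normedModType R} e (f : plane R -> V) x : V :=
  trace (box e.1) f x - trace (box e.2) f x.

Definition trace_gam {V : normedModType R} i K (v : pwfun V) x : V :=
  trace (box K `&` subdom G i) (pw_glue v) x.

Definition jump_gam K (v : pwfun R^o) x : R :=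
  trace_gam 0 K v x - trace_gam 1 K v x.

Definition jump_bdy K (v : pwfun R^o) x : R := trace (box K) (pw_glue v) x.

Definition int_sides (S : seq (rect R * rect R))
    (f : rect R * rect R -> plane R -> plane R -> R) : R :=
  \sum_(e <- S) boundary_integral e.1 (side_set e) (f e).

Definition int_gam (f : rect R -> plane R -> plane R -> R) : R :=
  \sum_(K <- mesh d) interface_integral G K (f K).

Definition int_bdy (f : rect R -> plane R -> plane R -> R) : R :=
  \sum_(K <- mesh d) boundary_integral K (bdy_set K) (f K).

Definition switch {V : lmodType R} (b : bool) (rm rp : V) : V :=
  b%:R *: rm + (1 - b%:R) *: rp.

(* <r^ . n, [[v]]>_E *)
Definition lift_rhs (r : pwfun (plane R)) (v : pwfun R^o) : R :=
  int_sides sides (fun e x n =>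
    dot (switch (beta_side d e) (trace (box e.1) (pw_glue r) x)
                                (trace (box e.2) (pw_glue r) x)) n *
    jump e (pw_glue v) x) +
  int_gam (fun K x n =>
    dot (switch (beta_gam d K) (trace_gam 0 K r x) (trace_gam 1 K r x)) n *
    jump_gam K v x) +
  int_bdy (fun K x n => dot (trace (box K) (pw_glue r) x) n * jump_bdy K v x).

Definition is_lifting (v : pwfun R) (Lv : pwfun (plane R)) : Prop :=
  broken_poly2 Lv /\
  forall r, broken_poly2 r -> ipM (pw_glue r) (pw_glue Lv) = lift_rhs r v.

(* The part of the jump forms on E^Gamma and E^bdy. *)
Definition jump_form_gam_bdy (alpha0 : R) (v w : pwfun R^o) : R :=
  int_gam (fun K x _ =>
    penalty_gam alpha0 K * jump_gam K v x * jump_gam K w x) +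
  int_bdy (fun K x _ =>
    penalty_bdy alpha0 K * jump_bdy K v x * jump_bdy K w x).

(* <alpha [[v]], [[w]]>_E *)
Definition jump_form (alpha0 : R) (v w : pwfun R^o) : R :=
  int_sides sides (fun e x _ =>
    penalty_side alpha0 e * jump e (pw_glue v) x * jump e (pw_glue w) x) +
  jump_form_gam_bdy alpha0 v w.

(* <alpha [[v]], [[w]]>_Ebar *)
Definition jump_form_bar (alpha0 : R) (v w : pwfun R^o) : R :=
  \sum_(i < 2) int_sides (sides_i i) (fun e x _ =>
    penalty_side alpha0 e * jump e (v i) x * jump e (w i) x) +
  jump_form_gam_bdy alpha0 v w.

Definition jump_norm (alpha0 : R) (v : pwfun R) : R :=
  Num.sqrt (jump_form alpha0 v v).

Definition a_h (alpha0 : R) (v w : pwfun R) : R :=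
  ipM (fun x => coef_fun x *: (gradh v x - pw_glue (lifting d v) x))
      (fun x => gradh w x - pw_glue (lifting d w) x) +
  jump_form_bar alpha0 v w.

Definition scaled (u : plane R -> plane R) x : plane R :=
  Num.sqrt (coef_fun x) *: u x.

Definition DG_norm (alpha0 : R) (v : pwfun R) : R :=
  Num.sqrt (normM (scaled (gradh v)) ^+ 2 + jump_form_bar alpha0 v v).

Definition admissible (delta0 kappa : R) : Prop :=
  [/\ (1 <= deg d)%N,
      forall i, 0 < coef d i,
      initial_mesh G (mesh0 d) /\
        induced_mesh G delta0 kappa (mesh0 d) (mesh d),
      forall K K', K \in mesh d -> K' \in mesh d -> K != K' ->
        ori d K K' = ~~ ori d K' K
    & forall v, broken_poly v -> is_lifting v (lifting d v)].

End Method.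
Arguments method : clear implicits.

(* Main.v *)
Require Import Defs.
From mathcomp Require Import all_boot all_order all_algebra.
From mathcomp Require Import all_classical all_reals all_analysis.
From mathcomp Require Import measurable_realfun ring lra.
Import Order.TTheory GRing.Theory Num.Theory.
Import numFieldNormedType.Exports.
Local Open Scope classical_set_scope.
Local Open Scope ring_scope.

Set Implicit Arguments.
Unset Strict Implicit.
Unset Printing Implicit Defensive.

(** Write g = nabla_h v and l = L(v).  Young's inequality
    |g|^2 <= (1 + c_L^2) |g - l|^2 + (1 + c_L^-2) |l|^2, integrated with weight
    a, together with the stability bound on l, gives
    ||a^(1/2) g||^2 <= (1 + c_L^2) (||a^(1/2) (g - l)||^2 + J), where J is the
    jump form on E; adding the jump form on Ebar costs at most one more unit of
    the constant once J is known to be bounded by that form.  For the latter,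
    at all but finitely many points of a side of E the jump of v is the jump of
    the single component v_i of the subdomain containing the point, and the
    side is then interior to Omega_i^h, hence in E_i^side. *)

(** * Product topology of the plane: squares, boxes, Borel measurability *)

Section PlaneTopology.
Context {R : realType}.
Implicit Types (x y : plane R) (A : set (plane R)) (K : rect R).

Lemma nbhs_squareP x A : nbhs x A <->
  exists2 e : R, 0 < e &
    forall y, `|y.1 - x.1| < e -> `|y.2 - x.2| < e -> A y.
Proof.
split=> [/nbhs_ballP[e /= e0 xA]|[e e0 xA]].
  exists e => // y y1 y2; apply: xA.
  by split; rewrite -ball_normE /= distrC.
apply/nbhs_ballP; exists e => //= y [].
by rewrite -!ball_normE /= => y1 y2; apply: xA; rewrite distrC.
Qed.

Lemma closure_squareP A x : closure A x <->
  forall e : R, 0 < e ->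
    exists y, [/\ A y, `|y.1 - x.1| < e & `|y.2 - x.2| < e].
Proof.
split=> [clA e e0|clA B /nbhs_squareP[e e0 xB]].
  have /clA[y [Ay [y1 y2]]] : nbhs x
      [set y | `|y.1 - x.1| < e /\ `|y.2 - x.2| < e].
    by apply/nbhs_squareP; exists e.
  by exists y.
by have [y [Ay y1 y2]] := clA e e0; exists y; split => //; apply: xB.
Qed.

Lemma box_setX K : box K = `]K.1.1, K.1.2[%classic `*` `]K.2.1, K.2.2[%classic.
Proof. by apply/seteqP; split => x /=; rewrite /box /= !in_itv. Qed.

Lemma measurable_box K : measurable (box K).
Proof. by rewrite box_setX; apply: measurableX; exact: measurable_itv. Qed.

Lemma open_box K : open (box K).
Proof.
rewrite openE => x; rewrite box_setX => -[x1 x2]; rewrite /interior.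
exists (`]K.1.1, K.1.2[%classic, `]K.2.1, K.2.2[%classic) => //=.
by split; apply: open_nbhs_nbhs; split => //; exact: interval_open.
Qed.

Lemma box_measure_fin K :
  ((lebesgue_measure \x lebesgue_measure)%E (box K) < +oo)%E.
Proof.
rewrite box_setX product_measure1E//; [|exact: measurable_itv..].
have fin (a b : R) : (lebesgue_measure `]a, b[%classic < +oo)%E.
  by rewrite lebesgue_measure_itv /=; case: ifP => _; rewrite -?EFinB ltry.
by apply: lte_mul_pinfty => //; [rewrite ge0_fin_numE//|]; exact: fin.
Qed.

(** Second countability: [A] is the union of the countably many boxes with rational end points
    contained in it, and each box is measurable for the product sigma-algebra. *)
Lemma plane_open_measurable A : open A -> measurable A.
Proof.
move=> oA.
pose rbox (q : (rat * rat) * (rat * rat)) : rect R :=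
  ((ratr q.1.1, ratr q.1.2), (ratr q.2.1, ratr q.2.2)).
have -> : A = \bigcup_q (if pselect (box (rbox q) `<=` A)
                         then box (rbox q) else set0).
  apply/seteqP; split => [x Ax|x [q _]]; last by case: pselect => // qA /qA.
  have /nbhs_squareP[e e0 xA] : nbhs x A by exact: open_nbhs_nbhs.
  have rlt (u v : R) : u < v -> {q : rat | u < ratr q < v}.
    by move=> /rat_in_itvoo; move/cid => [q]; rewrite in_itv; exists q.
  have ltl (u : R) : u - e < u by rewrite ltrBlDr ltrDl.
  have ltr (u : R) : u < u + e by rewrite ltrDl.
  have [a1 /andP[a11 a12]] := rlt _ _ (ltl x.1).
  have [b1 /andP[b11 b12]] := rlt _ _ (ltr x.1).
  have [a2 /andP[a21 a22]] := rlt _ _ (ltl x.2).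
  have [b2 /andP[b21 b22]] := rlt _ _ (ltr x.2).
  exists ((a1, b1), (a2, b2)) => //; case: pselect => [?|nA] /=; last first.
    exfalso; apply: nA.
    move=> y /= [/andP[y11 y12] /andP[y21 y22]].
    by apply: xA; rewrite ltr_distl; apply/andP; split; lra.
  by rewrite /box /= a12 b11 a22 b21.
apply: countable_bigcupT_measurable => [|q]; first exact: countableP.
by case: pselect => ?; [exact: measurable_box|exact: measurable0].
Qed.

Lemma plane_closed_measurable A : closed A -> measurable A.
Proof.
by move=> /closed_openC /plane_open_measurable /measurableC; rewrite setCK.
Qed.

Definition closed_box K : set (plane R) :=
  [set x | K.1.1 <= x.1 <= K.1.2 /\ K.2.1 <= x.2 <= K.2.2].

Lemma closure_box_sub K : closure (box K) `<=` closed_box K.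
Proof.
have cl (a b u : R) :
    (forall e, 0 < e -> exists2 v, a < v < b & `|v - u| < e) -> a <= u <= b.
  move=> H; apply/andP; split; rewrite leNgt; apply/negP => lt.
    have [|v /andP[v1 v2]] := H (a - u); first by rewrite subr_gt0.
    by rewrite ltr_distl => /andP[]; lra.
  have [|v /andP[v1 v2]] := H (u - b); first by rewrite subr_gt0.
  by rewrite ltr_distl => /andP[]; lra.
move=> x /closure_squareP clx; split; apply: cl => e /clx[y [[y1 y2] y1x y2x]].
  by exists y.1.
by exists y.2.
Qed.

Lemma closed_box_sub K : K.1.1 < K.1.2 -> K.2.1 < K.2.2 ->
  closed_box K `<=` closure (box K).
Proof.
have cl (a b u e : R) : a < b -> 0 < e -> a <= u <= b ->
    exists2 v, a < v < b & `|v - u| < e.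
  move=> ab e0 /andP[au ub].
  (* The witness is [u] moved a fraction [t] of the way to the midpoint of the interval: [t > 0]
     detaches it from the end points, and [t * (b - a) < e] keeps the shift below [e]. *)
  pose t := Num.min (1 / 2) (e / (b - a) / 2).
  have ba0 : 0 < b - a by lra.
  have t0 : 0 < t by rewrite lt_min !divr_gt0.
  have t1 : t <= 1 / 2 by rewrite ge_min lexx.
  have te : t * (b - a) < e.
    apply: (@le_lt_trans _ _ (e / (b - a) / 2 * (b - a))).
      by rewrite ler_wpM2r ?ge_min ?lexx ?orbT // ltW.
    have -> : e / (b - a) / 2 * (b - a) = e / 2 by field; lra.
    by lra.
  exists ((1 - t) * u + t * ((a + b) / 2)).
    by apply/andP; split; nra.
  by rewrite ltr_distl; apply/andP; split; nra.
move=> K1 K2 x [x1 x2]; apply/closure_squareP => e e0.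
have [v v1 v1x] := cl _ _ _ _ K1 e0 x1.
have [w w1 w1x] := cl _ _ _ _ K2 e0 x2.
by exists (v, w).
Qed.

End PlaneTopology.

(** * Traces, touching rectangles and Lipschitz boundaries *)

Section Geometry.
Context {R : realType}.
Implicit Types (x y : plane R) (A : set (plane R)) (K : rect R).

(** As [x] lies in the closure of [A], the filter defining [trace] is proper, so the limit is unique
    and depends only on the germ of [f] along [A]. *)
Lemma trace_eq A (f g : plane R -> R^o) x :
  closure A x -> {for x, continuous g} ->
  (\forall y \near x, A y -> f y = g y) -> trace A f x = g x.
Proof.
move=> clA cg fg; have PF : ProperFilter (within A (nbhs x)).
  exact: within_nbhs_proper.
apply: norm_cvg_lim; apply: (@cvg_trans _ (g @ within A (nbhs x))).
  by apply: near_eq_cvg; rewrite near_withinE; apply: filterS fg => y /[apply].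
by apply: cvg_trans cg; apply: cvg_app; exact: cvg_within.
Qed.

Lemma finite_at_most_two (T : Type) (B : set T) :
  (forall u v w : T, B u -> B v -> B w -> [\/ u = v, u = w | v = w]) ->
  finite_set B.
Proof.
move=> B2; have [->|/set0P[u Bu]] := eqVneq B set0; first exact: finite_set0.
have [[v [Bv vu]]|nB] := pselect (exists v, B v /\ v <> u).
  apply: (@sub_finite_set _ _ [set u; v]); last exact: finite_set2.
  by move=> w Bw; case: (B2 u v w) => // [?|->|->]; [congruence|left|right].
apply: (@sub_finite_set _ _ [set u]); last exact: finite_set1.
by move=> w Bw; apply: contrapT => wu; apply: nB; exists w.
Qed.

(** Otherwise the ranges overlap in both coordinates, and the point whose coordinates are the
    midpoints of the two overlaps lies in both boxes. *)
Lemma box_disjoint_sep K K' :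
  K.1.1 < K.1.2 -> K.2.1 < K.2.2 -> K'.1.1 < K'.1.2 -> K'.2.1 < K'.2.2 ->
  box K `&` box K' = set0 ->
  [\/ K.1.2 <= K'.1.1, K'.1.2 <= K.1.1, K.2.2 <= K'.2.1 | K'.2.2 <= K.2.1].
Proof.
have mid (a b a' b' : R) : a < b -> a' < b' -> a < b' -> a' < b ->
    exists u, a < u < b /\ a' < u < b'.
  move=> ? ? ? ?; exists ((Num.max a a' + Num.min b b') / 2).
  by case: (leP a a') => ?; case: (leP b b') => ?;
    split; apply/andP; split; lra.
move=> K1 K2 K'1 K'2 KK'.
case: (leP K.1.2 K'.1.1) => [|c1]; first by constructor 1.
case: (leP K'.1.2 K.1.1) => [|c2]; first by constructor 2.
case: (leP K.2.2 K'.2.1) => [|c3]; first by constructor 3.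
case: (leP K'.2.2 K.2.1) => [|c4]; first by constructor 4.
have [u [u1 u2]] := mid _ _ _ _ K1 K'1 c2 c1.
have [v [v1 v2]] := mid _ _ _ _ K2 K'2 c4 c3.
by have : set0 (u, v) by rewrite -KK'.
Qed.

Lemma not_vertexP K x : (forall b, x <> vertex K b) ->
  (x.1 = K.1.1 \/ x.1 = K.1.2) -> x.2 <> K.2.1 /\ x.2 <> K.2.2.
Proof.
move=> nv x1; split=> x2.
  by case: x1 => x1; [apply: (nv (false, false))|apply: (nv (true, false))];
    rewrite /vertex /= -x1 -x2 -surjective_pairing.
by case: x1 => x1; [apply: (nv (false, true))|apply: (nv (true, true))];
  rewrite /vertex /= -x1 -x2 -surjective_pairing.
Qed.

(** The inequalities force [u = b = a']: the rectangles abut along a vertical line, and the height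
    [v] is interior to both vertical ranges. A small square around the point is then split by that
    line into two halves, one in each rectangle. *)
Lemma adjacent_neighborhood (a b a' b' c d c' d' u v : R) :
  a < b -> a' < b' -> b <= a' -> u <= b -> a' <= u ->
  c < v < d -> c' < v < d' ->
  exists2 e, 0 < e & forall u' v', `|u' - u| < e -> `|v' - v| < e ->
    (a <= u' <= b /\ c <= v' <= d) \/ (a' <= u' <= b' /\ c' <= v' <= d').
Proof.
move=> + + ba' ub a'u; rewrite -subr_gt0 -[a' < b']subr_gt0.
have -> : u = b by apply/le_anti; rewrite ub (le_trans ba').
have <- : b = a' by apply/le_anti; rewrite ba' (le_trans a'u).
move=> ab ab'.
rewrite -![_ < v]subr_gt0 -![v < _]subr_gt0 => /andP[cv vd] /andP[cv' vd'].
exists (Num.min (Num.min (b - a) (b' - b))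
  (Num.min (Num.min (v - c) (d - v)) (Num.min (v - c') (d' - v)))).
  by rewrite !lt_min ab ab' cv vd cv' vd'.
move=> u' v'; rewrite !lt_min => /andP[/andP[u1 u2] _].
move=> /andP[_ /andP[/andP[v1 v2] /andP[v3 v4]]].
have lo (p q r : R) : `|q - p| < p - r -> r <= q.
  by rewrite ltr_distl => /andP[]; rewrite opprB addrC subrK => /ltW.
have hi (p q r : R) : `|q - p| < r - p -> q <= r.
  by rewrite ltr_distl => /andP[_]; rewrite addrC subrK => /ltW.
case: (leP u' b) => [u'b|/ltW bu'].
  by left; split; apply/andP; split => //;
    [exact: lo u1|exact: lo v1|exact: hi v2].
by right; split; apply/andP; split => //;
  [exact: hi u2|exact: lo v3|exact: hi v4].
Qed.

(* Two disjoint rectangles touching at a point that is a vertex of neither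
   lie on opposite sides of a common line through it. *)
Lemma interior_closure_boxU K K' x :
  K.1.1 < K.1.2 -> K.2.1 < K.2.2 -> K'.1.1 < K'.1.2 -> K'.2.1 < K'.2.2 ->
  box K `&` box K' = set0 ->
  closure (box K) x -> closure (box K') x ->
  (forall b, x <> vertex K b) -> (forall b, x <> vertex K' b) ->
  interior (closure (box K) `|` closure (box K')) x.
Proof.
move=> K1 K2 K'1 K'2 KK' xK xK' nK nK'.
have oo (a b u : R) : a <= u <= b -> u <> a /\ u <> b -> a < u < b.
  move=> /andP[au ub] [/eqP ua /eqP ub'].
  by rewrite !lt_neqAle au ub ub' eq_sym ua.
have adjacent1 (L L' : rect R) : closed_box L x -> closed_box L' x ->
    L.1.1 < L.1.2 -> L'.1.1 < L'.1.2 -> L.1.2 <= L'.1.1 ->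
    (forall b, x <> vertex L b) -> (forall b, x <> vertex L' b) ->
    interior (closed_box L `|` closed_box L') x.
  move=> [/andP[_ l] l2] [/andP[l' _] l2'] L1 L1' LL' nL nL'.
  (* The point lies on the common line; being a vertex of neither rectangle, it has its other
     coordinate strictly inside both ranges. *)
  have x1 : x.1 = L.1.2 by apply/le_anti; rewrite l (le_trans LL').
  have x1' : x.1 = L'.1.1 by apply/le_anti; rewrite l' (le_trans l).
  have [|e e0 He] := adjacent_neighborhood L1 L1' LL' l l' (oo _ _ _ l2 _)
    (oo _ _ _ l2' (not_vertexP nL' (or_introl x1'))).
    exact: not_vertexP nL (or_intror x1).
  by apply/nbhs_squareP; exists e => // y; exact: He.
(* Stacked rectangles: the previous case with the coordinates exchanged. *)
have adjacent2 (L L' : rect R) : closed_box L x -> closed_box L' x ->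
    L.2.1 < L.2.2 -> L'.2.1 < L'.2.2 -> L.2.2 <= L'.2.1 ->
    (forall b, x <> vertex L b) -> (forall b, x <> vertex L' b) ->
    interior (closed_box L `|` closed_box L') x.
  move=> [l2 /andP[_ l]] [l2' /andP[l' _]] L1 L1' LL' nL nL'.
  have x2 : x.2 = L.2.2 by apply/le_anti; rewrite l (le_trans LL').
  have x2' : x.2 = L'.2.1 by apply/le_anti; rewrite l' (le_trans l).
  have n : x.1 <> L.1.1 /\ x.1 <> L.1.2.
    by split=> x1; [have [] := not_vertexP nL (or_introl x1)|
                    have [] := not_vertexP nL (or_intror x1)].
  have n' : x.1 <> L'.1.1 /\ x.1 <> L'.1.2.
    by split=> x1; [have [] := not_vertexP nL' (or_introl x1)|
                    have [] := not_vertexP nL' (or_intror x1)].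
  have [e e0 He] := adjacent_neighborhood L1 L1' LL' l l' (oo _ _ _ l2 n)
    (oo _ _ _ l2' n').
  apply/nbhs_squareP; exists e => // y y1 y2.
  by case: (He y.2 y.1 y2 y1) => -[? ?]; [left|right].
have -> : closure (box K) = closed_box K.
  by apply/seteqP; split; [exact: closure_box_sub|exact: closed_box_sub].
have -> : closure (box K') = closed_box K'.
  by apply/seteqP; split; [exact: closure_box_sub|exact: closed_box_sub].
have {}xK := closure_box_sub xK; have {}xK' := closure_box_sub xK'.
case: (box_disjoint_sep K1 K2 K'1 K'2 KK') => ?.
- exact: adjacent1.
- by rewrite setUC; exact: adjacent1.
- exact: adjacent2.
- by rewrite setUC; exact: adjacent2.
Qed.

(** In the local frame the boundary point is on or above the graph of [phi]. Moving from it by [t]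
    along the upward normal [(- s, c)] reaches a point with a whole square above the graph, since
    [phi] grows at most linearly. *)
Lemma lipschitz_bd_outer A x : open A -> lipschitz_boundary A -> bd A x ->
  forall e : R, 0 < e ->
    exists y, [/\ `|y.1 - x.1| < e, `|y.2 - x.2| < e & ~ closure A y].
Proof.
move=> oA lipA bdx e e0.
have [c [s [r [k [phi [cs r0 kphi H]]]]]] := lipA x bdx.
have euclr z : `|z.1 - x.1| < r / 2 -> `|z.2 - x.2| < r / 2 ->
    eucl_dist z x < r.
  rewrite !ltr_norml => /andP[? ?] /andP[? ?].
  rewrite /eucl_dist /enorm /dot /= -(ger0_norm (ltW r0)) -sqrtr_sqr.
  by rewrite ltr_sqrt ?exprn_gt0//; nra.
(* If [phi 0 > 0], the point [x] would lie in the open set [A], hence in its interior, and not on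
   its boundary. *)
have phi0 : phi 0 <= 0.
  rewrite leNgt; apply/negP => phi0; case: bdx => _; apply.
  have [|_ xA] := H x; first by apply: euclr; rewrite subrr normr0 divr_gt0.
  apply: open_nbhs_nbhs; split => //; apply: xA.
  by rewrite subrr /dot /= !mul0r addr0.
have [c1 c2] : -1 <= c /\ c <= 1 by split; nra.
have [s1 s2] : -1 <= s /\ s <= 1 by split; nra.
(* The bound [r / 4] keeps all points used below within the radius where the graph description is
   valid. *)
have [t t0 [te tr]] : exists2 t : R, 0 < t & t < e /\ t <= r / 4.
  exists (Num.min (e / 2) (r / 4)); first by rewrite lt_min !divr_gt0.
  by rewrite ge_min lexx orbT gt_min; split => //; apply/orP; left; lra.
pose y : plane R := (x.1 - t * s, x.2 + t * c).
exists y; split => [||clAy].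
- by rewrite ltr_norml /=; apply/andP; split; nra.
- by rewrite ltr_norml /=; apply/andP; split; nra.
have k0 := normr_ge0 k.
(* A point [z] within [d] of [y] in each coordinate has height at least [t - 2 * d] and tangential
   coordinate at most [2 * d] in modulus, where [phi] is at most [2 * |k| * d]. This [d] makes the
   two bounds equal, so [z] is not below the graph. *)
pose d := t / (2 + 2 * `|k|).
have dE : (2 + 2 * `|k|) * d = t by rewrite /d; field; lra.
have d0 : 0 < d by rewrite divr_gt0; lra.
have [z [Az]] := (closure_squareP _ _).1 clAy d d0.
rewrite !ltr_norml /= => /andP[z1 z2] /andP[z3 z4].
have dt : d <= t / 2 by nra.
have [|+ _] := H z.
  by apply: euclr; rewrite ltr_norml; apply/andP; split; nra.
move=> /(_ Az).
set v := dot _ _; set u := dot (z - x) _.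
have -> : v = t * (c ^+ 2 + s ^+ 2) + (- s * (z.1 - y.1) + c * (z.2 - y.2)).
  by rewrite /v /dot /y /=; ring.
rewrite cs mulr1.
have uE : u = c * (z.1 - y.1) + s * (z.2 - y.2) by rewrite /u /dot /y /=; ring.
have ku : `|phi u - phi 0| <= k * `|u|.
  by have := kphi (u, 0); rewrite /= subr0; apply.
have u2 : `|u| <= 2 * d by rewrite ler_norml uE /=; apply/andP; split; nra.
have : phi u <= 2 * `|k| * d.
  have := ler_norm k; move: ku; rewrite ler_norml => /andP[_ ku] kk.
  have := normr_ge0 u; nra.
by rewrite /y /=; nra.
Qed.

End Geometry.

(** * Traces and gradients of piecewise polynomials *)

Section Polynomials.
Context {R : realType}.
Implicit Types (x y : plane R) (K : rect R).

Definition peval p (c : 'M[R]_p.+1) x : R :=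
  \sum_(i < p.+1) \sum_(j < p.+1) c i j * x.1 ^+ i * x.2 ^+ j.

Lemma continuous_peval p (c : 'M[R]_p.+1) :
  continuous (peval c : plane R -> R^o).
Proof.
apply: continuous_big => [|i _]; first exact: (@add_continuous R^o).
apply: continuous_big => [|j _ x]; first exact: (@add_continuous R^o).
apply: cvgM.
  apply: cvgM; first exact: cvg_cst.
  apply: (@continuous_comp _ _ _ fst (fun t : R => t ^+ i)).
    exact: cvg_fst.
  exact: exprn_continuous.
apply: (@continuous_comp _ _ _ snd (fun t : R => t ^+ j)); first exact: cvg_snd.
exact: exprn_continuous.
Qed.

(** With the other coordinate frozen, [peval c] is a univariate polynomial [q], whose analytic
    derivative is the formal one. *)
Lemma derive1_peval1 p (c : 'M[R]_p.+1) x :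
  derive1 (fun s => peval c (s, x.2)) x.1 =
  \sum_(i < p.+1) \sum_(j < p.+1) c i j * (x.1 ^+ i.-1 *+ i) * x.2 ^+ j.
Proof.
pose q := \sum_(i < p.+1) (\sum_(j < p.+1) c i j * x.2 ^+ j) *: 'X^i : {poly R}.
have -> : (fun s => peval c (s, x.2)) = horner q.
  apply/funext => s; rewrite horner_sum; apply: eq_bigr => i _.
  rewrite hornerZ hornerXn mulr_suml; apply: eq_bigr => j _.
  by rewrite mulrAC.
rewrite -derivE raddf_sum horner_sum; apply: eq_bigr => i _.
rewrite /= derivZ derivXn hornerZ hornerMn hornerXn mulr_suml.
by apply: eq_bigr => j _; rewrite mulrAC.
Qed.

Lemma derive1_peval2 p (c : 'M[R]_p.+1) x :
  derive1 (fun s => peval c (x.1, s)) x.2 =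
  \sum_(i < p.+1) \sum_(j < p.+1) c i j * x.1 ^+ i * (x.2 ^+ j.-1 *+ j).
Proof.
pose q := \sum_(j < p.+1) (\sum_(i < p.+1) c i j * x.1 ^+ i) *: 'X^j : {poly R}.
rewrite exchange_big; have -> : (fun s => peval c (x.1, s)) = horner q.
  apply/funext => s; rewrite /peval exchange_big horner_sum.
  by apply: eq_bigr => j _; rewrite hornerZ hornerXn mulr_suml.
rewrite -derivE raddf_sum horner_sum; apply: eq_bigr => i _.
by rewrite /= derivZ derivXn hornerZ hornerMn hornerXn mulr_suml.
Qed.

Lemma trace_Qp p (c : 'M[R]_p.+1) K (f : plane R -> R^o) x :
  closure (box K) x ->
  (\forall y \near x, box K y -> f y = peval c y) ->
  trace (box K) f x = peval c x.
Proof. by move=> xK; apply: trace_eq => //; exact: continuous_peval. Qed.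

(** Lets the gradient of a function that is polynomial only on an open box be computed from the
    polynomial there. *)
Lemma grad_near (f g : plane R -> R) x :
  (\forall y \near x, f y = g y) -> grad f x = grad g x.
Proof.
move=> /nbhs_squareP[e e0 fg]; rewrite /grad; congr pair.
  rewrite !derive1E; apply: near_eq_derive.
  apply/nbhs_ballP; exists e => //= s xs.
  by apply: fg; rewrite /= ?subrr ?normr0// distrC; exact: xs.
rewrite !derive1E; apply: near_eq_derive.
apply/nbhs_ballP; exists e => //= s xs.
by apply: fg; rewrite /= ?subrr ?normr0// distrC; exact: xs.
Qed.

End Polynomials.

(** * Bounded measurable functions on an element *)

Section BoundedMeasurable.
Context {R : realType} (K : rect R).
Implicit Types f g : plane R -> R.

(** Boundedness is recorded in place of integrability because it is stable under products; on a box,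
    which has finite measure, it yields integrability. *)
Definition bmeas f : Prop :=
  measurable_fun (box K) f /\ exists M, forall x, box K x -> `|f x| <= M.

Lemma bmeas_eq f g : (forall x, box K x -> g x = f x) -> bmeas f -> bmeas g.
Proof.
move=> gf [mf [M fM]]; split.
  by apply: eq_measurable_fun mf => x; rewrite inE => /gf.
by exists M => x Kx; rewrite gf // fM.
Qed.

Lemma bmeas_cst (a : R) : bmeas (fun=> a).
Proof. by split; [exact: measurable_cst|exists `|a|]. Qed.

Lemma bmeasD f g : bmeas f -> bmeas g -> bmeas (fun x => f x + g x).
Proof.
move=> [mf [M fM]] [mg [N gN]]; split; first exact: measurable_funD.
exists (M + N) => x Kx; apply: le_trans (ler_normD _ _) _.
by rewrite lerD ?fM ?gN.
Qed.

Lemma bmeasM f g : bmeas f -> bmeas g -> bmeas (fun x => f x * g x).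
Proof.
move=> [mf [M fM]] [mg [N gN]]; split; first exact: measurable_funM.
by exists (M * N) => x Kx; rewrite normrM ler_pM ?fM ?gN.
Qed.

Lemma bmeasB f g : bmeas f -> bmeas g -> bmeas (fun x => f x - g x).
Proof.
move=> bf bg; apply: (@bmeas_eq (fun x => f x + -1 * g x)) => [x _|].
  by rewrite mulN1r.
by apply: bmeasD => //; apply: bmeasM => //; exact: bmeas_cst.
Qed.

Lemma bmeas_sum n (F : 'I_n -> plane R -> R) :
  (forall i, bmeas (F i)) -> bmeas (fun x => \sum_(i < n) F i x).
Proof.
elim: n F => [|n IH] F bF.
  by apply: bmeas_eq (bmeas_cst 0) => x _; rewrite big_ord0.
apply: (@bmeas_eq (fun x => \sum_(i < n) F (widen_ord (leqnSn n) i) x +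
                            F ord_max x)) => [x _|].
  by rewrite big_ord_recr.
by apply: bmeasD => //; exact: IH.
Qed.

Lemma bmeasX f n : bmeas f -> bmeas (fun x => f x ^+ n).
Proof.
move=> bf; elim: n => [|n IH].
  by apply: bmeas_eq (bmeas_cst 1) => x _; rewrite expr0.
by apply: bmeas_eq (bmeasM bf IH) => x _; rewrite exprS.
Qed.

Lemma bmeas_coord1 : bmeas fst.
Proof.
split; first exact: measurable_funTS.
exists (`|K.1.1| + `|K.1.2|) => x [/andP[/ltW x1 /ltW x2] _].
have := ler_norm K.1.2; have := ler_norm (- K.1.1); rewrite normrN.
have := normr_ge0 K.1.1; have := normr_ge0 K.1.2.
by move=> ? ? ? ?; rewrite ler_norml; apply/andP; split; lra.
Qed.

Lemma bmeas_coord2 : bmeas snd.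
Proof.
split; first exact: measurable_funTS.
exists (`|K.2.1| + `|K.2.2|) => x [_ /andP[/ltW x1 /ltW x2]].
have := ler_norm K.2.2; have := ler_norm (- K.2.1); rewrite normrN.
have := normr_ge0 K.2.1; have := normr_ge0 K.2.2.
by move=> ? ? ? ?; rewrite ler_norml; apply/andP; split; lra.
Qed.

Lemma bmeas_indic A : measurable A -> bmeas \1_A.
Proof.
move=> mA; split; first exact: measurable_indic.
by exists 1 => x _; rewrite indicE; case: (_ \in _); rewrite ?normr1 ?normr0.
Qed.

Lemma bmeas_integrable f : bmeas f ->
  (lebesgue_measure \x lebesgue_measure)%E.-integrable (box K) (EFin \o f).
Proof.
move=> [mf [M fM]]; apply: measurable_bounded_integrable => //.
- exact: measurable_box.
- exact: box_measure_fin.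
exists M; split; first exact: num_real.
by move=> N MN x /fM /le_trans; apply; exact: ltW.
Qed.

Lemma bmeas_Qp p f : in_Qp p K f -> bmeas f.
Proof.
move=> [c fc]; apply: bmeas_eq fc _.
apply: bmeas_sum => i; apply: bmeas_sum => j.
apply: bmeasM; last exact: bmeasX bmeas_coord2.
by apply: bmeasM; [exact: bmeas_cst|exact: bmeasX bmeas_coord1].
Qed.

Lemma bmeas_grad p f : in_Qp p K f ->
  bmeas (fun x => (grad f x).1) /\ bmeas (fun x => (grad f x).2).
Proof.
move=> [c fc].
have gradE x : box K x -> grad f x = grad (peval c) x.
  move=> Kx; apply: grad_near; apply: filterS (fc) _.
  by apply: open_nbhs_nbhs; split => //; exact: open_box.
have natrX (u : R) n k : u ^+ n *+ k = u ^+ n * k%:R by rewrite mulr_natr.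
split.
  apply: (@bmeas_eq (fun x => derive1 (fun s => peval c (s, x.2)) x.1)).
    by move=> x Kx; rewrite gradE.
  apply: bmeas_eq => [x _|]; first exact: derive1_peval1.
  apply: bmeas_sum => i; apply: bmeas_sum => j.
  apply: bmeasM; last exact: bmeasX bmeas_coord2.
  apply: bmeasM; first exact: bmeas_cst.
  apply: bmeas_eq => [x _|]; first exact: natrX.
  by apply: bmeasM; [exact: bmeasX bmeas_coord1|exact: bmeas_cst].
apply: (@bmeas_eq (fun x => derive1 (fun s => peval c (x.1, s)) x.2)).
  by move=> x Kx; rewrite gradE.
apply: bmeas_eq => [x _|]; first exact: derive1_peval2.
apply: bmeas_sum => i; apply: bmeas_sum => j.
apply: bmeasM.
  by apply: bmeasM; [exact: bmeas_cst|exact: bmeasX bmeas_coord1].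
apply: bmeas_eq => [x _|]; first exact: natrX.
by apply: bmeasM; [exact: bmeasX bmeas_coord2|exact: bmeas_cst].
Qed.

End BoundedMeasurable.

(** * Weighted Young inequality for the volume terms *)

Section Volume.
Context {R : realType}.
Implicit Types (G : geometry R) (d : method R) (K : rect R) (x : plane R).

Lemma measurable_subdom G i : interface_geometry G -> measurable (subdom G i).
Proof.
move=> [[oD _ _ _ _] _ [oD1 _ _ _] _]; rewrite /subdom.
case: ifP => _; first exact: plane_open_measurable.
apply: measurableD; first exact: plane_open_measurable.
by apply: plane_closed_measurable; exact: closed_closure.
Qed.

Lemma pw_glue_pair G (v : pwfun (plane R)) x :
  pw_glue G v x = (\sum_(i < 2) \1_(subdom G i) x * (v i x).1,
                   \sum_(i < 2) \1_(subdom G i) x * (v i x).2).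
Proof. by rewrite /pw_glue !big_ord_recl !big_ord0 !addr0. Qed.

Lemma bmeas_pw_glue G K (v : pwfun (plane R)) : interface_geometry G ->
  (forall i, bmeas K (fun x => (v i x).1) /\ bmeas K (fun x => (v i x).2)) ->
  bmeas K (fun x => (pw_glue G v x).1) /\ bmeas K (fun x => (pw_glue G v x).2).
Proof.
move=> geoG bv; split.
  apply: bmeas_eq => [x _|]; first by rewrite pw_glue_pair.
  apply: bmeas_sum => i; apply: bmeasM; last exact: (bv i).1.
  by apply: bmeas_indic; exact: measurable_subdom.
apply: bmeas_eq => [x _|]; first by rewrite pw_glue_pair.
apply: bmeas_sum => i; apply: bmeasM; last exact: (bv i).2.
by apply: bmeas_indic; exact: measurable_subdom.
Qed.

Lemma bmeas_coef_fun G d K : interface_geometry G -> bmeas K (coef_fun G d).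
Proof.
move=> geoG; apply: bmeas_sum => i; apply: bmeasM; last exact: bmeas_cst.
by apply: bmeas_indic; exact: measurable_subdom.
Qed.

Lemma coef_fun_ge0 G d x : (forall i, 0 < coef d i) -> 0 <= coef_fun G d x.
Proof.
move=> c0; apply: sumr_ge0 => i _; rewrite indicE.
by apply: mulr_ge0 => //; exact: ltW.
Qed.

Lemma dotZl (a : R) x y : dot (a *: x) y = a * dot x y.
Proof. by rewrite /dot /= -!mulrA -mulrDr. Qed.

Lemma dotZr (a : R) x y : dot x (a *: y) = a * dot x y.
Proof. by rewrite /dot /= mulrCA (mulrCA x.2) -mulrDr. Qed.

Lemma dot_ge0 x : 0 <= dot x x.
Proof. by rewrite addr_ge0 // -expr2 sqr_ge0. Qed.

(** The difference of the two sides is the complete square [c * |x - y - c^-1 *: y|^2]. *)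
Lemma dot_young (c : R) x y : 0 < c ->
  dot x x <= (1 + c) * dot (x - y) (x - y) + (1 + c^-1) * dot y y.
Proof.
move=> c0; rewrite -subr_ge0.
suff -> : (1 + c) * dot (x - y) (x - y) + (1 + c^-1) * dot y y - dot x x =
    c * dot (x - y - c^-1 *: y) (x - y - c^-1 *: y).
  by rewrite mulr_ge0 ?dot_ge0 ?ltW.
set z := x - y - _.
have -> : z = (x.1 - y.1 - c^-1 * y.1, x.2 - y.2 - c^-1 * y.2) by [].
by rewrite /dot /=; field; rewrite gt_eqF.
Qed.

(** Pointwise Young inequality, multiplied by the nonnegative coefficient and integrated element by
    element; the [bmeas] assumptions supply the integrability that linearity and monotonicity of the
    integral require. *)
Lemma ipM_young G d (c : R) (g l : plane R -> plane R) :
  interface_geometry G -> (forall i, 0 < coef d i) -> 0 < c ->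
  (forall K, K \in mesh d ->
     bmeas K (fun x => (g x).1) /\ bmeas K (fun x => (g x).2)) ->
  (forall K, K \in mesh d ->
     bmeas K (fun x => (l x).1) /\ bmeas K (fun x => (l x).2)) ->
  ipM d (scaled G d g) (scaled G d g) <=
  (1 + c) * ipM d (fun x => coef_fun G d x *: (g x - l x))
                  (fun x => g x - l x) +
  (1 + c^-1) * ipM d (scaled G d l) (scaled G d l).
Proof.
move=> geoG a0 c0 bg bl.
have dot_scaled u x : dot (scaled G d u x) (scaled G d u x) =
    coef_fun G d x * dot (u x) (u x).
  by rewrite dotZl dotZr mulrA -expr2 sqr_sqrtr // coef_fun_ge0.
have badot K u : bmeas K (fun x => (u x).1) /\ bmeas K (fun x => (u x).2) ->
    bmeas K (fun x => coef_fun G d x * dot (u x) (u x)).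
  move=> [u1 u2]; apply: bmeasM; first exact: bmeas_coef_fun.
  by apply: bmeasD; apply: bmeasM.
rewrite /ipM !mulr_sumr -big_split /= big_seq [leRHS]big_seq.
apply: ler_sum => K KM; have mK := measurable_box K.
have [g1 g2] := bg K KM; have [l1 l2] := bl K KM.
have Ig := bmeas_integrable (badot K g (conj g1 g2)).
have Il := bmeas_integrable (badot K l (conj l1 l2)).
have bgl := badot K (fun x => g x - l x) (conj (bmeasB g1 l1) (bmeasB g2 l2)).
have Igl := bmeas_integrable bgl.
have bc (r : R) f : bmeas K f -> bmeas K (fun x => r * f x).
  by apply: bmeasM; exact: bmeas_cst.
under eq_Rintegral do rewrite dot_scaled.
under [X in _ <= (1 + c) * X + _]eq_Rintegral do rewrite dotZl.
under [X in _ <= _ + (1 + c^-1) * X]eq_Rintegral do rewrite dot_scaled.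
rewrite -!RintegralZl // -RintegralD //; last 2 first.
- by apply: bmeas_integrable; apply: bc.
- by apply: bmeas_integrable; apply: bc; apply: badot.
apply: le_Rintegral => // [|x _].
  apply: bmeas_integrable; apply: bmeasD; apply: bc => //.
  exact: badot.
rewrite mulrCA [X in _ + X]mulrCA -mulrDr ler_wpM2l ?coef_fun_ge0//.
exact: dot_young.
Qed.

Lemma ipM_scaled_ge0 G d u : 0 <= ipM d (scaled G d u) (scaled G d u).
Proof.
by apply: sumr_ge0 => K _; apply: Rintegral_ge0 => x _; exact: dot_ge0.
Qed.

End Volume.

(** * Position of the interface relative to subdomains and elements *)

Section Interface.
Context {R : realType}.
Implicit Types (G : geometry R) (d : method R) (K : rect R) (x y : plane R).

(** A Lipschitz boundary point of Omega_1 has points outside the closure of Omega_1 arbitrarily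
    near; since that closure lies in the open set Omega, these points belong to Omega_2. *)
Lemma bd_dom1_Gam G : interface_geometry G -> bd (dom1 G) `<=` Gam G.
Proof.
move=> [[oD _ _ _ _] _ [oD1 _ clD1 lipD1] _] x bdx; split => //.
have clx : closure (dom1 G) x by case: bdx.
split; last first.
  by move=> /interior_subset [_]; exact.
have /nbhs_squareP[e1 e10 xD] : nbhs x (dom G).
  by apply: open_nbhs_nbhs; split => //; exact: clD1.
apply/closure_squareP => e e0.
have [|y [y1 y2 ny]] := lipschitz_bd_outer oD1 lipD1 bdx (e := Num.min e e1).
  by rewrite lt_min e0.
move: y1 y2; rewrite !lt_min => /andP[y1 y1'] /andP[y2 y2'].
by exists y; split => //; split => //; exact: xD.
Qed.

(** An element meeting the interface is crossed twice. One that does not meet it cannot be a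
    macro-element, which would contain an interface element, so it belongs to the initial mesh and
    is crossed at most twice. *)
Lemma finite_Gam_bd G d delta0 kappa K : admissible G d delta0 kappa ->
  K \in mesh d -> finite_set (Gam G `&` bd (box K)).
Proof.
move=> [_ _ [[_ T2] [_ M1 M2]] _ _] KM.
have [mK|nmK] := pselect (Defs.meets G K).
  have [_ _ [s [s' [x [y [_ _ _ _ ->]]]]] _] := M2 K KM mK.
  exact: finite_set2.
have [KT|[K0 [_ [x [K0x Gx]] K0K _ _]]] := M1 K KM; last first.
  by exfalso; apply: nmK; exists x; split => //; exact: K0K.
have [[_ _ two] _] := T2 K KT.
exact: finite_at_most_two.
Qed.

Lemma pw_glue_subdom G i (v : pwfun R^o) x : subdom G i x ->
  pw_glue G v x = v i x.
Proof.
have dom12 : dom1 G x -> ~ dom2 G x.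
  by move=> D1 [_]; apply; exact: subset_closure.
rewrite /pw_glue !big_ord_recl big_ord0 addr0 !indicE.
have [->|i1] : i = 0 \/ i = 1.
  by case: i => -[|[|//]] ?; [left|right]; exact: val_inj.
  rewrite /subdom /= => D1; rewrite mem_set // memNset; last exact: dom12.
  by rewrite scale1r scale0r addr0.
rewrite i1 /subdom /= => D2; rewrite memNset; last by move=> /dom12.
rewrite mem_set // scale1r scale0r add0r; congr (v _ x); exact: val_inj.
Qed.

(** Meaningful off the interface only: the subdomain filling Omega near [x], even when [x] itself
    lies on the boundary of Omega. *)
Definition phase G x : 'I_2 := if `[< dom1 G x >] then 0 else 1.

Lemma near_phase G x : interface_geometry G -> ~ Gam G x ->
  \forall y \near x, dom G y -> subdom G (phase G x) y.
Proof.
move=> geoG nGx; have nbd : ~ bd (dom1 G) x by move=> /(bd_dom1_Gam geoG).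
have oD1 : open (dom1 G) by case: geoG => _ _ [].
rewrite /phase; case: asboolP => D1x.
  by apply: filterS (open_nbhs_nbhs (conj oD1 D1x)) => y.
have nclx : ~ closure (dom1 G) x.
  by move=> clx; apply: nbd; split => // /interior_subset.
have oC : open (~` closure (dom1 G)).
  by apply: closed_openC; exact: closed_closure.
by apply: filterS (open_nbhs_nbhs (conj oC nclx)) => y.
Qed.

(** This is what places a side in [sides_i]: a point interior to the hull is not on its boundary. *)
Lemma hull_touching d G i K K' x : cartesian_mesh (dom G) (mesh d) ->
  K \in mesh d -> K' \in mesh d -> K != K' ->
  closure (box K) x -> closure (box K') x ->
  (forall b, x <> vertex K b) -> (forall b, x <> vertex K' b) ->
  box K `&` subdom G i !=set0 -> box K' `&` subdom G i !=set0 ->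
  hull G d i x.
Proof.
move=> [_ nd disj _] KM K'M KK' xK xK' nK nK' Ki K'i.
have [K1 K2 _] := nd _ KM; have [K1' K2' _] := nd _ K'M.
have := interior_closure_boxU K1 K2 K1' K2' (disj _ _ KM K'M KK') xK xK' nK nK'.
by apply: interiorS => y [?|?]; [exists K|exists K'].
Qed.

End Interface.

(** * Comparison of integrals along element sides *)

Section SideIntegrals.
Context {R : realType}.
Implicit Types (G : geometry R) (d : method R) (K : rect R) (x y : plane R).

(** Meant for [f] built from traces of a glued function, whose measurability is not given: [f]
    coincides with [q0] on [U] and with [q1] off [U], except on the finite, hence negligible, set
    [F]. *)
Lemma le_Rintegral_piecewise (D U F : set R) (f q0 q1 g : R -> R) :
  measurable D -> measurable U -> finite_set F ->
  (forall t, D t -> 0 <= f t) -> (forall t, D t -> 0 <= g t) ->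
  measurable_fun D q0 -> measurable_fun D q1 ->
  lebesgue_measure.-integrable D (EFin \o g) ->
  (forall t, D t -> ~ F t -> U t -> f t = q0 t) ->
  (forall t, D t -> ~ F t -> ~ U t -> f t = q1 t) ->
  (forall t, D t -> ~ F t -> f t <= g t) ->
  \int[lebesgue_measure]_(t in D) f t <= \int[lebesgue_measure]_(t in D) g t.
Proof.
move=> mD mU finF f0 g0 mq0 mq1 ig fq0 fq1 fg.
have mcount (E : set R) : E `<=` F -> measurable E.
  move=> EF; apply: countable_measurable => [t|]; first exact: measurable_set1.
  by apply: finite_set_countable; exact: sub_finite_set finF.
have mF : measurable F by exact: mcount.
have mf : measurable_fun D f.
  have -> : D = (D `&` F) `|` ((D `\` F) `&` U `|` (D `\` F) `\` U).
    apply/seteqP; split => [t Dt|t [[]|[[[]]|[[]]]]//].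
    have [?|nF] := pselect (F t); [by left|right].
    by have [?|?] := pselect (U t); [left|right].
  have mDF : measurable (D `\` F) by exact: measurableD.
  have mDU : measurable ((D `\` F) `&` U) by exact: measurableI.
  have mDnU : measurable ((D `\` F) `\` U) by exact: measurableD.
  apply/measurable_funU; [exact: measurableI|exact: measurableU|].
  (* Every subset of [F] is measurable, so the values of [f] on [F] may be arbitrary. *)
  split; first by move=> _ Y _; apply: mcount => t [[]].
  apply/measurable_funU => //; split.
    apply: (eq_measurable_fun q0).
      by move=> t; rewrite inE => -[[? ?] ?]; rewrite fq0.
    by apply: measurable_funS mq0 => // t [[]].
  apply: (eq_measurable_fun q1).
    by move=> t; rewrite inE => -[[? ?] ?]; rewrite fq1.
  by apply: measurable_funS mq1 => // t [[]].
have mg : measurable_fun D g.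
  by apply/measurable_EFinP; exact: measurable_int ig.
have le : (\int[lebesgue_measure]_(t in D) (f t)%:E <=
           \int[lebesgue_measure]_(t in D) (g t)%:E)%E.
  apply: ae_ge0_le_integral => //.
  - exact/measurable_EFinP.
  - exact/measurable_EFinP.
  exists F; split => //.
    by apply: countable_lebesgue_measure0; exact: finite_set_countable.
  move=> t /= nle; apply: contrapT => nF; apply: nle => Dt.
  by rewrite lee_fin fg.
have fing : (\int[lebesgue_measure]_(t in D) (g t)%:E)%E \is a fin_num.
  exact: integrable_fin_num.
(* [fine] sends infinite values to 0 and is monotone only between finite ones; finiteness for [f] is
   inherited from the bound [g]. *)
rewrite /Rintegral fine_le // ge0_fin_numE.
  by apply: le_lt_trans le _; rewrite ltey_eq fing.
by apply: integral_ge0 => t Dt; rewrite lee_fin f0.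
Qed.

Lemma continuous_side_point K s : continuous (side_point K s).
Proof.
move=> t A /nbhs_squareP[e e0 tA]; apply/nbhs_ballP; exists e => //= u.
rewrite -ball_normE /= distrC => tu; apply: tA; move: tu;
  by rewrite /side_point; case: s.1; rewrite //= subrr normr0.
Qed.

Lemma side_point_inj K s : injective (side_point K s).
Proof. by rewrite /side_point; case: s.1 => t u []. Qed.

Lemma continuous_itv_integrable (f : R -> R^o) (a b : R) (D : set R) :
  continuous f -> measurable D -> D `<=` `[a, b]%classic ->
  lebesgue_measure.-integrable D (EFin \o f).
Proof.
move=> cf mD Dab.
have : lebesgue_measure.-integrable `[a, b]%classic (EFin \o f).
  apply: continuous_compact_integrable; first exact: segment_compact.
  exact: continuous_subspaceT.
by apply: integrableS => //; exact: measurable_itv.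
Qed.

Section Linear.
Context disp (T : measurableType disp) (mu : {measure set T -> \bar R}).
Variables (D : set T) (a b : R) (f g : T -> R).
Hypotheses (intf : mu.-integrable D (EFin \o f))
           (intg : mu.-integrable D (EFin \o g)) (mD : measurable D).

Lemma integrable_lin2 : mu.-integrable D (EFin \o (fun t => a * f t + b * g t)).
Proof.
exact: (integrableD mD (integrableZl mD a intf) (integrableZl mD b intg)).
Qed.

Lemma Rintegral_lin2 : \int[mu]_(t in D) (a * f t + b * g t) =
  a * \int[mu]_(t in D) f t + b * \int[mu]_(t in D) g t.
Proof.
by rewrite RintegralD // ?RintegralZl //;
  [exact: (integrableZl mD a intf)|exact: (integrableZl mD b intg)].
Qed.

End Linear.

Lemma sum_ord2 (V : nmodType) (F : 'I_2 -> V) : \sum_(i < 2) F i = F 0 + F 1.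
Proof.
rewrite !big_ord_recl big_ord0 addr0; congr (_ + F _); exact: val_inj.
Qed.

Lemma closed_side_set (e : rect R * rect R) : closed (side_set e).
Proof.
have cbd A : closed (@bd R A).
  apply: closedI; first exact: closed_closure.
  by apply: open_closedC; exact: open_interior.
exact: closedI.
Qed.

Lemma sup_ge0 (A : set R) : (forall t, A t -> 0 <= t) -> 0 <= sup A.
Proof.
move=> A0; have [supA|/sup_out->//] := pselect (has_sup A).
have [t At] := supA.1; apply: le_trans (A0 t At) _.
by apply: ub_le_sup => //; exact: supA.2.
Qed.

(** Each [side_max] is a maximum started at 0, hence nonnegative whatever the element quantities
    are. *)
Lemma penalty_ge0 G d (alpha0 h : R) e : 0 < alpha0 -> 0 <= h ->
  0 <= penalty G d alpha0 e h.
Proof.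
have side_max_ge0 f : 0 <= side_max d f e.
  rewrite /side_max; elim: (mesh d) => [|K M IH]; first by rewrite big_nil.
  by rewrite big_cons; case: ifP => // _; rewrite le_max IH orbT.
move=> a0 h0; rewrite /penalty mulr_ge0 ?sqr_ge0//.
by do ?apply: mulr_ge0; rewrite ?invr_ge0 // ltW.
Qed.

Lemma diam_ge0 (A : set (plane R)) : 0 <= diam A.
Proof. by apply: sup_ge0 => _ [z _ <-]; exact: sqrtr_ge0. Qed.

End SideIntegrals.

(** * The jump form on E is bounded by the one on Ebar *)

Section JumpForms.
Context {R : realType}.
Implicit Types (G : geometry R) (d : method R) (K : rect R) (x y : plane R).

Let side_dom (e : rect R * rect R) s : set R :=
  [set t | (side_range e.1 s).1 < t < (side_range e.1 s).2 /\
           side_set e (side_point e.1 s t)].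

Let jump_sq G d (alpha0 : R) e s (w : plane R -> R^o) t : R :=
  penalty_side G d alpha0 e * jump e w (side_point e.1 s t) *
  jump e w (side_point e.1 s t).

(** A side may cross the interface, so the component carrying the glued jump can change along it.
    The integrand is therefore compared pointwise with the sum over both components, each counted
    only if the side is kept in [sides_i]; all terms are nonnegative. *)
Lemma side_jump_le G d (delta0 kappa alpha0 : R) (v : pwfun R^o) e s :
  interface_geometry G -> admissible G d delta0 kappa -> 0 < alpha0 ->
  broken_poly d v -> e \in sides d ->
  \int[lebesgue_measure]_(t in side_dom e s)
    jump_sq G d alpha0 e s (pw_glue G v) t <=
  \sum_(i < 2) if e \in sides_i G d i
    then \int[lebesgue_measure]_(t in side_dom e s)
           jump_sq G d alpha0 e s (v i) t
    else 0.
Proof.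
move=> geoG admd a0 bv eS; have [_ _ [_ [cm _ _]] _ _] := admd.
have [K1M K2M K12] : [/\ e.1 \in mesh d, e.2 \in mesh d & e.1 != e.2].
  move: eS; rewrite mem_filter => /andP[/andP[e12 _]].
  by move=> /allpairsP[z [z1 z2 ez]]; move: e12; rewrite ez.
pose D := side_dom e s; pose sq := jump_sq G d alpha0 e s.
have al0 : 0 <= penalty_side G d alpha0 e.
  by apply: penalty_ge0 => //; rewrite divr_ge0 // addr_ge0 // diam_ge0.
have sq_ge0 w t : 0 <= sq w t.
  by rewrite /sq /jump_sq -mulrA -expr2 mulr_ge0 ?sqr_ge0.
pose sp := side_point e.1 s.
have mD : measurable D.
  apply: measurableI.
    exact: measurable_itv `](side_range e.1 s).1, (side_range e.1 s).2[.
  apply: closed_measurable; apply: (@closed_comp _ _ sp); last exact: closed_side_set.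
  by move=> t _; exact: continuous_side_point.
pose U := sp @^-1` dom1 G.
have mU : measurable U.
  apply: open_measurable; apply: open_comp; last by case: geoG => _ _ [].
  by move=> t _; exact: continuous_side_point.
(* Exceptional parameters: interface points, where the glued function has no single component, and
   vertices of either element, where the two closures need not cover a neighborhood. A hanging node
   is a vertex of [e.2] inside a side of [e.1]. *)
pose F := sp @^-1` ((Gam G `&` bd (box e.1)) `|`
                    (range (vertex e.1) `|` range (vertex e.2))).
have finF : finite_set F.
  apply: finite_preimage; first by move=> t u _ _; exact: side_point_inj.
  rewrite !finite_setU; split; first exact: finite_Gam_bd admd K1M.
  by split; apply: finite_image; exact: finite_finset.
have c i K (KM : K \in mesh d) := cid (bv i K KM).
pose c1 i := sval (c i _ K1M); pose c2 i := sval (c i _ K2M).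
have c1E i x : box e.1 x -> v i x = peval (c1 i) x
  by exact: (svalP (c i _ K1M)).
have c2E i x : box e.2 x -> v i x = peval (c2 i) x
  by exact: (svalP (c i _ K2M)).
(* The squared jump of [v_i] with traces replaced by the polynomials of the two elements; continuous
   in [t], hence integrable on [D]. *)
pose q i t : R^o := penalty_side G d alpha0 e *
  (peval (c1 i) (sp t) - peval (c2 i) (sp t)) *
  (peval (c1 i) (sp t) - peval (c2 i) (sp t)).
have q_ge0 i t : 0 <= q i t by rewrite /q -mulrA -expr2 mulr_ge0 ?sqr_ge0.
have cq i : continuous (q i).
  move=> t.
  have cp p (cc : 'M[R]_p.+1) :
      {for t, continuous (fun t => peval cc (sp t) : R^o)}.
    apply: (@continuous_comp _ _ _ sp (peval cc : plane R -> R^o)).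
      exact: continuous_side_point.
    exact: continuous_peval.
  have cj : {for t, continuous
      (fun t => peval (c1 i) (sp t) - peval (c2 i) (sp t) : R^o)}.
    by apply: cvgB; exact: cp.
  by apply: cvgM => //; apply: cvgM => //; exact: cvg_cst.
have iq i : lebesgue_measure.-integrable D (EFin \o q i).
  apply: (@continuous_itv_integrable _ _
    (side_range e.1 s).1 (side_range e.1 s).2) => //.
  by move=> t [/andP[/ltW t1 /ltW t2] _]; rewrite /= in_itv /= t1.
have sqE i t : D t -> sq (v i) t = q i t.
  move=> [_ [[x1 _] [x2 _]]]; rewrite /sq /jump_sq /q /jump.
  by rewrite (trace_Qp (c := c1 i)) ?(trace_Qp (c := c2 i)) //;
    apply/nbhs_squareP; exists 1 => // y _ _; [exact: c2E|exact: c1E].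
(* Near a nonexceptional point both elements lie, locally, in the single subdomain given by [phase],
   so the traces of the glued function are those of that component. *)
have key t : D t -> ~ F t ->
    sq (pw_glue G v) t = q (phase G (sp t)) t /\
    e \in sides_i G d (phase G (sp t)).
  move=> Dt nF; have [_ [bd1 bd2]] := Dt; have [x1 _] := bd1; have [x2 _] := bd2.
  have nG : ~ Gam G (sp t) by move=> Gt; apply: nF; left.
  have nv1 b : sp t <> vertex e.1 b
    by move=> E; apply: nF; right; left; exists b.
  have nv2 b : sp t <> vertex e.2 b
    by move=> E; apply: nF; right; right; exists b.
  have ph := near_phase geoG nG.
  have meet K : K \in mesh d -> closure (box K) (sp t) ->
      box K `&` subdom G (phase G (sp t)) !=set0.
    move=> KM /(_ _ ph)[y [Ky dy]]; exists y; split => //; apply: dy.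
    by have [_ /(_ _ KM)[_ _ Kdom] _ _] := cm; exact: Kdom.
  have tr K (KM : K \in mesh d) : closure (box K) (sp t) ->
      trace (box K) (pw_glue G v) (sp t) =
      peval (sval (c (phase G (sp t)) K KM)) (sp t).
    move=> xK; apply: trace_Qp => //; apply: filterS ph => y dy Ky.
    rewrite (pw_glue_subdom (i := phase G (sp t))).
      exact: (svalP (c _ K KM)).
    by apply: dy; have [_ /(_ _ KM)[_ _ Kdom] _ _] := cm; exact: Kdom.
  split; first by rewrite /sq /jump_sq /jump (tr _ K1M) // (tr _ K2M).
  rewrite mem_filter eS andbT; apply/asboolP; split.
    by left; split => //; exact: meet.
  (* A side contained in the boundary of the hull would contain [sp t], which is interior to the
     hull. *)
  move=> /(_ (sp t) (conj bd1 bd2)) [_]; apply.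
  rewrite /interior; apply: open_nbhs_nbhs; split; first exact: open_interior.
  by apply: (hull_touching cm K1M K2M K12 x1 x2 nv1 nv2); exact: meet.
(* Weights 0 or 1 make the right-hand side the integral of one function [g]; by [key] the term equal
   to the left integrand has weight 1. *)
pose b i : R := (e \in sides_i G d i)%:R.
pose g t := b 0 * q 0 t + b 1 * q 1 t.
apply: (@le_trans _ _ (\int[lebesgue_measure]_(t in D) g t)); last first.
  rewrite (Rintegral_lin2 (b 0) (b 1) (iq 0) (iq 1) mD).
  rewrite sum_ord2.
  have E i : b i * \int[lebesgue_measure]_(t in D) q i t =
      if e \in sides_i G d i
      then \int[lebesgue_measure]_(t in D) sq (v i) t else 0.
    rewrite /b; case: ifP => _; rewrite ?mul0r // mul1r.
    by apply: eq_Rintegral => t; rewrite inE => /sqE.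
  by rewrite (E 0) (E 1).
have mq i : measurable_fun D (q i).
  by apply/measurable_EFinP; exact: measurable_int (iq i).
apply: (@le_Rintegral_piecewise _ D U F _ (q 0) (q 1)) => //.
- by move=> t _; rewrite addr_ge0 // mulr_ge0.
- exact: integrable_lin2 (iq 0) (iq 1) mD.
- move=> t Dt nF Ut; apply: etrans (key t Dt nF).1 _.
  by rewrite /phase asboolT.
- move=> t Dt nF nUt; apply: etrans (key t Dt nF).1 _.
  by rewrite /phase asboolF.
move=> t Dt nF; have [sqt] := key t Dt nF.
rewrite -[jump_sq _ _ _ _ _ _ _]/(sq (pw_glue G v) t) sqt.
have bq i : 0 <= b i * q i t by rewrite mulr_ge0.
rewrite /phase /g; case: ifP => _ bi.
  by rewrite [b 0]/b bi mul1r lerDl.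
by rewrite [b 1]/b bi mul1r lerDr.
Qed.

(** Rewrites the sums over [sides_i] as one sum over all sides, with zeros for the discarded ones,
    so that the two jump forms can be compared side by side. *)
Lemma sum_int_sides G d
    (f : 'I_2 -> rect R * rect R -> plane R -> plane R -> R) :
  \sum_(i < 2) int_sides (sides_i G d i) (f i) =
  \sum_(e <- sides d) \sum_(s : bool * bool) \sum_(i < 2)
    if e \in sides_i G d i
    then \int[lebesgue_measure]_(t in side_dom e s)
           f i e (side_point e.1 s t) (side_normal s)
    else 0.
Proof.
under [RHS]eq_bigr do rewrite exchange_big.
rewrite [RHS]exchange_big /=; apply: eq_bigr => i _.
have -> : sides_i G d i = [seq e <- sides d | e \in sides_i G d i].
  rewrite [LHS]/sides_i; apply: eq_in_filter => e eS.
  by rewrite mem_filter eS andbT.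
rewrite /int_sides big_filter big_mkcond /=; apply: eq_bigr => e _.
rewrite [in RHS]mem_filter /=; case: (boolP (e \in sides_i G d i)) => eS.
  by move: eS; rewrite mem_filter => /andP[_ ->].
by rewrite big1.
Qed.

Lemma jump_form_le G d (delta0 kappa alpha0 : R) (v : pwfun R^o) :
  interface_geometry G -> admissible G d delta0 kappa -> 0 < alpha0 ->
  broken_poly d v ->
  jump_form G d alpha0 v v <= jump_form_bar G d alpha0 v v.
Proof.
(* The interface and boundary contributions are the same in both forms and cancel. *)
move=> geoG admd a0 bv; rewrite /jump_form /jump_form_bar lerD2r.
rewrite sum_int_sides /int_sides big_seq [leRHS]big_seq.
apply: ler_sum => e eS; apply: ler_sum => s _.
exact: (side_jump_le s geoG admd a0 bv eS).
Qed.

Lemma jump_form_ge0 G d (alpha0 : R) (v : pwfun R^o) : 0 < alpha0 ->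
  0 <= jump_form G d alpha0 v v.
Proof.
move=> a0.
have sq0 (a u : R) : 0 <= a -> 0 <= a * u * u.
  by move=> ?; rewrite -mulrA -expr2 mulr_ge0 ?sqr_ge0.
do 2?[apply: addr_ge0]; apply: sumr_ge0 => K _; apply: sumr_ge0 => s _;
  apply: Rintegral_ge0 => t _.
- by apply/sq0/penalty_ge0 => //; rewrite divr_ge0 // addr_ge0 // diam_ge0.
- apply: mulr_ge0; last exact: sqrtr_ge0.
  by apply/sq0/penalty_ge0 => //; exact: diam_ge0.
- by apply/sq0/penalty_ge0 => //; exact: diam_ge0.
Qed.

End JumpForms.

(* D is an arbitrary class of discretizations (degree, meshes, coefficient)
   on which the constant c_L is uniform. *)
Theorem theorem2p1 (R : realType) (G : geometry R)
    (delta0 alpha0 kappa c_L : R) (D : set (method R)) :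
  interface_geometry G ->
  0 < delta0 < 1 / 2 ->
  0 < alpha0 ->
  0 < c_L ->
  (forall d, D d -> admissible G d delta0 kappa) ->
  (forall d, D d -> forall v, broken_poly d v ->
    normM d (scaled G d (pw_glue G (lifting d v))) <= c_L * jump_norm G d alpha0 v) ->
  forall d, D d -> forall v, broken_poly d v ->
    a_h G d alpha0 v v >= (4 + c_L ^+ 2)^-1 * DG_norm G d alpha0 v ^+ 2.
Proof.
move=> geoG _ a0 c0 adm lift d Dd v bv; have admd := adm d Dd.
have [_ coef0 _ _ /(_ v bv)[[bL1 bL2] _]] := admd.
have J0 := jump_form_ge0 G d v a0.
have JB := jump_form_le geoG admd a0 bv.
(* The Young parameter [c_L ^+ 2] is chosen so that [(1 + c_L^-2) * c_L^2 = 1 + c_L^2]: after the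
   stability bound, the volume and jump terms carry the same factor. *)
have Y := @ipM_young R G d (c_L ^+ 2) (gradh G v) (pw_glue G (lifting d v))
  geoG coef0 (exprn_gt0 2 c0).
have {Y}Y := Y (fun K KM => bmeas_pw_glue geoG (fun i => bmeas_grad (bv i K KM)))
  (fun K KM => bmeas_pw_glue geoG
    (fun i => conj (bmeas_Qp (bL1 i K KM)) (bmeas_Qp (bL2 i K KM)))).
have L : ipM d (scaled G d (pw_glue G (lifting d v)))
    (scaled G d (pw_glue G (lifting d v))) <=
    c_L ^+ 2 * jump_form G d alpha0 v v.
  have H := lift d Dd v bv.
  have := ler_pM (sqrtr_ge0 _) (sqrtr_ge0 _) H H.
  by rewrite -!expr2 exprMn !sqr_sqrtr // ipM_scaled_ge0.
have A0 := ipM_scaled_ge0 G d (gradh G v).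
rewrite /DG_norm /normM sqr_sqrtr //; last first.
  by rewrite sqr_sqrtr // addr_ge0 // (le_trans J0).
rewrite sqr_sqrtr // /a_h mulrC ler_pdivrMr ?addr_gt0 ?exprn_gt0 //.
move: Y; set N := ipM d (fun x => coef_fun G d x *: _) _ => Y.
have N0 : 0 <= N.
  apply: sumr_ge0 => K _; apply: Rintegral_ge0 => x _.
  by rewrite dotZl mulr_ge0 ?dot_ge0 ?coef_fun_ge0.
move: Y L JB J0; set A := ipM _ _ _; set B := ipM _ _ _.
set J := jump_form _ _ _ _ _; set J' := jump_form_bar _ _ _ _ _ => Y L JB J0.
have {L}L : (1 + (c_L ^+ 2)^-1) * B <= (1 + c_L ^+ 2) * J'.
  apply: (@le_trans _ _ ((1 + (c_L ^+ 2)^-1) * (c_L ^+ 2 * J'))).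
    rewrite ler_wpM2l ?addr_ge0 ?invr_ge0 ?sqr_ge0// (le_trans L)//.
    by rewrite ler_wpM2l ?sqr_ge0.
  by rewrite mulrA mulrDl mul1r mulVf ?expf_eq0 ?gt_eqF// addrC.
have J'0 : 0 <= J' by exact: le_trans JB.
(* The estimates add up to [A + J' <= (1 + c_L^2) * N + (2 + c_L^2) * J'], which is at most
   [(4 + c_L^2) * (N + J')] because [N] and [J'] are nonnegative. *)
have := mulr_ge0 (sqr_ge0 c_L) N0; lra.
Qed.
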